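(* Let $\eta:\mathbb{R}^n\times\mathbb{R}^n\to\mathbb{R}^n$ and $w:\mathbb{R}^n\to\mathbb{R}^n$ be maps, let $g_1,\dots,g_m:\mathbb{R}^n\to\mathbb{R}$ be $w$-preinvex functions on $\mathbb{R}^n$ with respect to $\eta$ and $w$, and let $X=\{z\in\mathbb{R}^n : g_i(z)\le 0,\ i=1,\dots,m\}$ be a non-empty $w$-invex set with respect to $\eta$ and $w$. Let $h:\mathbb{R}^n\to\mathbb{R}$ be $w$-prequasi-invex on $X$ with respect to $\eta$ and $w$, and let $\gamma=\min_{z\in X}h(z)$ (the minimum being assumed to be attained). Then the set $Y=\{z\in X : h(z)=\gamma\}$ of optimal solutions of the problem of minimizing $h(z)$ subject to $z\in X$ is $w$-invex with respect to $\eta$ and $w$. If, moreover, $h$ is $w$-strictly prequasi-invex on $X$ with respect to $\eta$ and $w$, then $Y$ is a singleton.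
   Context: Let $\eta:\mathbb{R}^n\times\mathbb{R}^n\to\mathbb{R}^n$ and $w:\mathbb{R}^n\to\mathbb{R}^n$. A non-empty set $X\subseteq\mathbb{R}^n$ is $w$-invex (with respect to $\eta$ and $w$) if $w(z_2)+\delta\,\eta(z_1,w(z_2))\in X$ for all $z_1,z_2\in X$ and $\delta\in[0,1]$. Given a $w$-invex set $X$, a function $h$ is: $w$-preinvex on $X$ if $h(w(z_2)+\delta\,\eta(z_1,w(z_2)))\le \delta h(z_1)+(1-\delta)h(z_2)$ for all $z_1,z_2\in X$ and $\delta\in[0,1]$; $w$-prequasi-invex on $X$ if $h(w(z_2)+\delta\,\eta(z_1,w(z_2)))\le\max\{h(z_1),h(z_2)\}$ for all $z_1,z_2\in X$ and $\delta\in[0,1]$; $w$-strictly prequasi-invex on $X$ if $h(w(z_2)+\delta\,\eta(z_1,w(z_2)))<\max\{h(z_1),h(z_2)\}$ for all $z_1,z_2\in X$ with $z_1\neq z_2$ and all $\delta\in(0,1)$. *)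

(* Defs.v *)
From mathcomp Require Import all_boot all_order all_algebra.
From mathcomp Require Import boolp classical_sets reals.

Set Implicit Arguments.
Unset Strict Implicit.
Unset Printing Implicit Defensive.

Import Order.TTheory GRing.Theory Num.Theory.
Local Open Scope classical_set_scope.
Local Open Scope ring_scope.

Section WInvex.
Variables (R : realType) (n : nat).
Variables (eta : 'rV[R]_n -> 'rV[R]_n -> 'rV[R]_n) (w : 'rV[R]_n -> 'rV[R]_n).
Implicit Types (X : set 'rV[R]_n) (h : 'rV[R]_n -> R).

Definition w_invex X : Prop :=
  X !=set0 /\
  forall (z1 z2 : 'rV[R]_n) (delta : R), X z1 -> X z2 -> 0 <= delta <= 1 ->
    X (w z2 + delta *: eta z1 (w z2)).

(* The three notions below are meant for a w_invex set X; they do not include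
   that condition. *)
Definition w_preinvex X h : Prop :=
  forall (z1 z2 : 'rV[R]_n) (delta : R), X z1 -> X z2 -> 0 <= delta <= 1 ->
    h (w z2 + delta *: eta z1 (w z2)) <= delta * h z1 + (1 - delta) * h z2.

Definition w_prequasi_invex X h : Prop :=
  forall (z1 z2 : 'rV[R]_n) (delta : R), X z1 -> X z2 -> 0 <= delta <= 1 ->
    h (w z2 + delta *: eta z1 (w z2)) <= Num.max (h z1) (h z2).

Definition w_strictly_prequasi_invex X h : Prop :=
  forall (z1 z2 : 'rV[R]_n) (delta : R), X z1 -> X z2 -> z1 <> z2 ->
    0 < delta < 1 ->
    h (w z2 + delta *: eta z1 (w z2)) < Num.max (h z1) (h z2).

End WInvex.

Definition feasible_set (R : realType) (n m : nat)
    (g : 'I_m -> 'rV[R]_n -> R) : set 'rV[R]_n :=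
  [set z | forall i, g i z <= 0].

Definition is_minimum (R : realType) (n : nat) (X : set 'rV[R]_n)
    (h : 'rV[R]_n -> R) (gamma : R) : Prop :=
  (h @` X) gamma /\ lbound (h @` X) gamma.

Definition optimal_set (R : realType) (n : nat) (X : set 'rV[R]_n)
    (h : 'rV[R]_n -> R) (gamma : R) : set 'rV[R]_n :=
  [set z | X z /\ h z = gamma].

(* Main.v *)
Require Import Defs.
From mathcomp Require Import all_boot all_order all_algebra.
From mathcomp Require Import boolp classical_sets reals.

Import Order.TTheory GRing.Theory Num.Theory.
Local Open Scope classical_set_scope.
Local Open Scope ring_scope.

(** At two optimal points the maximum bounding [h] at [w z2 + delta *: eta z1 (w z2)] collapses to
    [gamma]. Since [X] is w-invex this point is feasible, so its value is also at least [gamma], and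
    it is optimal. Under the strict inequality the same collapse would give a feasible value below
    [gamma], so two distinct optima cannot coexist. *)

Lemma optimal_set_w_invex (R : realType) (n : nat)
    (eta : 'rV[R]_n -> 'rV[R]_n -> 'rV[R]_n) (w : 'rV[R]_n -> 'rV[R]_n)
    (X : set 'rV[R]_n) (h : 'rV[R]_n -> R) (gamma : R) :
  w_invex eta w X -> w_prequasi_invex eta w X h -> is_minimum X h gamma ->
  w_invex eta w (optimal_set X h gamma).
Proof.
move=> [_ Xinv] hq [[z0 Xz0 hz0] lb]; split; first by exists z0.
move=> z1 z2 d [X1 h1] [X2 h2] d01; have Xz := Xinv _ _ _ X1 X2 d01.
(* Quasi-invexity gives the upper bound, minimality of [gamma] the lower one. *)
split=> //; apply/eqP; rewrite eq_le; apply/andP; split.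
  by have := hq _ _ _ X1 X2 d01; rewrite h1 h2 maxxx.
by apply: lb; exists (w z2 + d *: eta z1 (w z2)).
Qed.

Lemma optimal_set_singleton (R : realType) (n : nat)
    (eta : 'rV[R]_n -> 'rV[R]_n -> 'rV[R]_n) (w : 'rV[R]_n -> 'rV[R]_n)
    (X : set 'rV[R]_n) (h : 'rV[R]_n -> R) (gamma : R) :
  w_invex eta w X -> w_strictly_prequasi_invex eta w X h ->
  is_minimum X h gamma -> exists z, optimal_set X h gamma = [set z].
Proof.
move=> [_ Xinv] hs [[z0 Xz0 hz0] lb]; exists z0.
apply/seteqP; split=> [z [Xz hz] /=|_ -> //].
have [//|/eqP zz0] := eqVneq z z0.
(* Any [delta] in the open interval would do, as strictness is available there; one half is a
   convenient choice. *)
have /andP[d0 d1] : 0 < (2^-1 : R) < 1.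
  by rewrite invr_gt0 ltr0n invf_lt1 ?ltr0n // ltr1n.
have d01 : 0 <= (2^-1 : R) <= 1 by rewrite !ltW.
have := hs z z0 2^-1 Xz Xz0 zz0; rewrite d0 d1 hz hz0 maxxx => /(_ isT).
(* A value strictly below [gamma] contradicts [lb] once the point is known to be feasible. *)
rewrite ltNge => /negP[]; apply: lb.
by exists (w z0 + 2^-1 *: eta z (w z0)) => //; exact: Xinv.
Qed.

Theorem theorem4p2 (R : realType) (n m : nat)
    (eta : 'rV[R]_n -> 'rV[R]_n -> 'rV[R]_n) (w : 'rV[R]_n -> 'rV[R]_n)
    (g : 'I_m -> 'rV[R]_n -> R) (h : 'rV[R]_n -> R) (gamma : R)
    (g_preinvex : forall i, w_preinvex eta w setT (g i))
    (X_invex : w_invex eta w (feasible_set g))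
    (h_prequasi : w_prequasi_invex eta w (feasible_set g) h)
    (gamma_min : is_minimum (feasible_set g) h gamma) :
  w_invex eta w (optimal_set (feasible_set g) h gamma) /\
  (w_strictly_prequasi_invex eta w (feasible_set g) h ->
   exists z, optimal_set (feasible_set g) h gamma = [set z]).
Proof.
split; first exact: optimal_set_w_invex.
by move=> h_strict; apply: optimal_set_singleton X_invex h_strict gamma_min.
Qed.
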